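(* Let $n\ge 1$ and let $f\in\mathcal{H}_{n,3}$ be a cubic homogeneous polynomial with integer coefficients, with $\overline{f}>\underline{f}$, and assume that $f$ has a rational global minimizer in $\Delta_n$, i.e. there is $x^*\in\Delta_n\cap\mathbb{Q}^n$ with $f(x^* )=\underline{f}$. Then $\rho_r(f)=O(1/r^2)$ as $r\to\infty$; that is, there is a constant $C$ (which may depend on $f$ but not on $r$) such that $\rho_r(f)\le C/r^2$ for all sufficiently large integers $r$.
   Context: $\mathcal{H}_{n,d}$ is the set of homogeneous polynomials of degree $d$ in $n$ variables with real coefficients. $\Delta_n=\{x\in\mathbb{R}^n: x_i\ge 0 \text{ for all } i,\ \sum_{i=1}^n x_i=1\}$ is the standard simplex. For an integer $r\ge1$, $\Delta(n,r)=\{x\in\Delta_n: rx\in\mathbb{N}^n\}$ (with $0\in\mathbb{N}$). Set $\underline{f}=\min_{x\in\Delta_n}f(x)$, $\overline{f}=\max_{x\in\Delta_n}f(x)$, $f_{\Delta(n,r)}=\min_{x\in\Delta(n,r)}f(x)$, and $$\rho_r(f)=\frac{f_{\Delta(n,r)}-\underline{f}}{\overline{f}-\underline{f}}.$$ *)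

(* Defs.v *)
From HB Require Import structures.
From mathcomp Require Import all_boot all_order all_algebra.
From mathcomp Require Import boolp classical_sets functions cardinality set_interval reals.
From mathcomp Require Import topology num_normedtype.
From mathcomp Require Import pseudometric_normed_Zmodule matrix_normedtype.
(* Importing normed_module makes the notations of mpoly unusable. *)
From mathcomp Require normed_module realfun derive.
From mathcomp Require Import mpoly.
Set Implicit Arguments.
Unset Strict Implicit.
Unset Printing Implicit Defensive.
Import Order.TTheory GRing.Theory Num.Theory.
Import normed_module.numFieldNormedType.Exports.
Local Open Scope classical_set_scope.
Local Open Scope ring_scope.

(* Points of R^n are row vectors 'rV[R]_n, so that [x ord0 i] is the i-th
   coordinate of x. *)
Definition simplex (R : realType) (n : nat) : set 'rV[R]_n :=
  [set x | (forall i, 0 <= x ord0 i) /\ \sum_i x ord0 i = 1].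
Arguments simplex : clear implicits.

(* For r = 0 this is all of the simplex, a value of no interest. *)
Definition grid (R : realType) (n r : nat) : set 'rV[R]_n :=
  [set x | simplex R n x /\ forall i, r%:R * x ord0 i \is a Num.nat].
Arguments grid : clear implicits.

Definition polyfun (R : realType) (n : nat) (f : {mpoly R[n]}) :
  'rV[R]_n -> R := fun x => f.@[x ord0].

(* Least and greatest element of a set of reals; both are an arbitrary real if
   there is none. Lemmas min_simplexP, max_simplexP and min_gridP show that this
   does not happen below. *)
Definition set_min (R : realType) (E : set R) : R := get (E `&` lbound E).
Definition set_max (R : realType) (E : set R) : R := get (E `&` ubound E).

Definition min_simplex (R : realType) (n : nat) (f : {mpoly R[n]}) : R :=
  set_min (polyfun f @` simplex R n).

Definition max_simplex (R : realType) (n : nat) (f : {mpoly R[n]}) : R :=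
  set_max (polyfun f @` simplex R n).

Definition min_grid (R : realType) (n : nat) (f : {mpoly R[n]}) (r : nat) : R :=
  set_min (polyfun f @` grid R n r).

Definition rho (R : realType) (n : nat) (f : {mpoly R[n]}) (r : nat) : R :=
  (min_grid f r - min_simplex f) / (max_simplex f - min_simplex f).

Section MinimaExist.
Variables (R : realType) (n : nat).
Hypothesis n_gt0 : (0 < n)%N.
Implicit Type f : {mpoly R[n]}.

Lemma set_minP (T : Type) (g : T -> R) (A : set T) c :
  A c -> (forall x, A x -> g c <= g x) -> set_min (g @` A) = g c.
Proof.
move=> Ac cmin; apply: xget_unique.
  by split; [exists c | move=> _ [x Ax <-]; exact: cmin].
move=> _ [[y Ay <-] lby]; apply/eqP; rewrite eq_le cmin// andbT.
by apply: lby; exists c.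
Qed.

Lemma set_maxP (T : Type) (g : T -> R) (A : set T) c :
  A c -> (forall x, A x -> g x <= g c) -> set_max (g @` A) = g c.
Proof.
move=> Ac cmax; apply: xget_unique.
  by split; [exists c | move=> _ [x Ax <-]; exact: cmax].
move=> _ [[y Ay <-] uby]; apply/eqP; rewrite eq_le cmax//=.
by apply: uby; exists c.
Qed.

Lemma polyfun_continuous f : continuous (polyfun f).
Proof.
elim/mpolyind: f => [|c m p _ _ IH] x.
  have -> : polyfun (0 : {mpoly R[n]}) = cst 0.
    by apply/funext => y; rewrite /polyfun meval0.
  exact: cst_continuous.
have -> : polyfun (c *: 'X_[m] + p) =
    (fun y => c * \prod_i y ord0 i ^+ m i + polyfun p y).
  by apply/funext => y; rewrite /polyfun mevalD mevalZ mevalX.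
have prod_cont : continuous (fun y : 'rV[R]_n => \prod_i y ord0 i ^+ m i).
  apply: continuous_big => [|i _ y]; first exact: normed_module.mul_continuous.
  apply: (@cvg_comp _ _ _ (fun y : 'rV[R]_n => y ord0 i) (fun z => z ^+ m i)).
    exact: coord_continuous.
  exact: realfun.exprn_continuous.
apply: (@cvgD _ _ _ _ (nbhs_filter x)); last exact: IH.
exact: (@normed_module.cvgMl_tmp _ _ _ (nbhs_filter x) _ c _ (prod_cont x)).
Qed.

Lemma simplex_neq0 : simplex R n !=set0.
Proof.
exists (delta_mx ord0 (Ordinal n_gt0)); split=> [i|].
  by rewrite mxE ler0n.
rewrite (bigD1 (Ordinal n_gt0)) //= mxE !eqxx big1 ?addr0// => i /negbTE ni.
by rewrite mxE ni andbF.
Qed.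

Lemma simplex_compact : compact (simplex R n).
Proof.
have cI : compact [set x : 'rV[R]_n | forall i, `[0, 1]%classic (x ord0 i)].
  by apply: (@rV_compact R n (fun=> `[0, 1]%classic)) => _;
  exact: normed_module.segment_compact.
apply: (subclosed_compact _ cI) => [|x [x0 x1] i].
  have -> : simplex R n = \bigcap_(i in [set: 'I_n])
      ((fun x : 'rV[R]_n => x ord0 i) @^-1` [set y | 0 <= y])
      `&` (fun x : 'rV[R]_n => \sum_i x ord0 i) @^-1` [set y | y = 1].
    by apply/seteqP; split=> x [x0 x1]; split=> // i; [move=> _|]; exact: x0.
  apply: closedI.
    apply: closed_bigI => i _; apply: (preimage_closed _ (@closed_ge _ 0)).
    by move=> x _; exact: coord_continuous.
  apply: (preimage_closed _ (@closed_eq _ 1)) => x _.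
  apply: (continuous_big (x0 := 0)) x => [|i _]; first exact: add_continuous.
  exact: coord_continuous.
rewrite /= in_itv /= x0 -x1 (bigD1 i)//= lerDl.
by apply: sumr_ge0 => j _; exact: x0.
Qed.

Lemma min_simplexP f : exists2 c, simplex R n c &
  min_simplex f = polyfun f c /\
  forall x, simplex R n x -> polyfun f c <= polyfun f x.
Proof.
have [c /set_mem cA cmin] := derive.compact_EVT_min simplex_neq0 simplex_compact
  (continuous_subspaceT (@polyfun_continuous f)).
have {}cmin x : simplex R n x -> polyfun f c <= polyfun f x.
  by move=> /mem_set; exact: cmin.
by exists c => //; split=> //; exact: set_minP.
Qed.

Lemma max_simplexP f : exists2 c, simplex R n c &
  max_simplex f = polyfun f c /\
  forall x, simplex R n x -> polyfun f x <= polyfun f c.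
Proof.
have [c /set_mem cA cmax] := derive.compact_EVT_max simplex_neq0 simplex_compact
  (continuous_subspaceT (@polyfun_continuous f)).
have {}cmax x : simplex R n x -> polyfun f x <= polyfun f c.
  by move=> /mem_set; exact: cmax.
by exists c => //; split=> //; exact: set_maxP.
Qed.

Lemma grid_neq0 r : grid R n r !=set0.
Proof.
exists (delta_mx ord0 (Ordinal n_gt0)); split=> [|i]; last first.
  by rewrite mxE -natrM natr_nat.
split=> [i|]; first by rewrite mxE ler0n.
rewrite (bigD1 (Ordinal n_gt0)) //= mxE !eqxx big1 ?addr0// => i /negbTE ni.
by rewrite mxE ni andbF.
Qed.

Lemma grid_finite r : (0 < r)%N -> finite_set (grid R n r).
Proof.
move=> r_gt0.
pose h (k : {ffun 'I_n -> 'I_r.+1}) : 'rV[R]_n := \row_i ((k i)%:R / r%:R).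
apply: (@sub_finite_set _ _ (h @` [set: {ffun 'I_n -> 'I_r.+1}])); last first.
  by apply: finite_image; exact: finite_finset.
move=> x [[x0 x1] xr].
have r0 : 0 < r%:R :> R by rewrite ltr0n.
exists [ffun i => inord (Num.truncn (r%:R * x ord0 i))] => //.
apply/rowP => i; rewrite mxE ffunE.
have xi1 : x ord0 i <= 1.
  by rewrite -x1 (bigD1 i)//= lerDl; apply: sumr_ge0 => j _; exact: x0.
rewrite inordK; first by rewrite truncnK// mulrAC mulfV ?mul1r// gt_eqF.
by rewrite ltnS -(ler_nat R) truncnK// ler_piMr// ltW.
Qed.

Lemma min_gridP f r : (0 < r)%N -> exists2 c, grid R n r c &
  min_grid f r = polyfun f c /\
  forall x, grid R n r x -> polyfun f c <= polyfun f x.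
Proof.
move=> r_gt0.
have [c /set_mem cA cmin] := derive.compact_EVT_min (grid_neq0 r)
  (finite_compact (grid_finite r_gt0))
  (continuous_subspaceT (@polyfun_continuous f)).
have {}cmin x : grid R n r x -> polyfun f c <= polyfun f x.
  by move=> /mem_set; exact: cmin.
by exists c => //; split=> //; exact: set_minP.
Qed.

End MinimaExist.

(* Main.v *)
Require Import Defs.
From mathcomp Require Import all_boot all_order all_algebra.
From mathcomp Require Import boolp classical_sets functions cardinality reals.
From mathcomp Require Import mpoly.
From mathcomp Require Import ring lra.
Import Order.TTheory GRing.Theory Num.Theory.
Local Open Scope classical_set_scope.
Local Open Scope ring_scope.

(** The minimizer x has a common denominator m, so x itself lies in every grid
    whose mesh is 1/(m k). For a general r, write r = m k + s with s < m, pick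
    a vertex e of the simplex with x_e > 0, and put the s leftover units of mass
    on e: the point x + (s/r) (e - x) has r-th multiple m k x + s e, hence
    belongs to the grid of mesh 1/r ([mem_grid_shift]). Since x_e > 0, the line
    through x and e stays in the simplex for a short while on both sides of x
    ([simplex_shift]), so f restricted to this line is a univariate polynomial
    ([polyfun_line]) with an interior local minimum at x. Its linear term
    therefore vanishes, and f exceeds its minimum by at most a constant times
    (s/r)^2 <= (m/r)^2 ([poly_local_min_quadratic]). The direction e - x does not
    depend on r, so neither does the constant. *)

(** A nonzero linear coefficient b would dominate the quadratic remainder at a
    small parameter of the sign opposite to b, making p smaller than p.[0]. *)
Lemma poly_local_min_quadratic (R : realFieldType) (p : {poly R}) (e : R) :
  0 < e -> (forall t, `|t| <= e -> p.[0] <= p.[t]) ->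
  exists2 M : R, 0 < M &
    forall t, `|t| <= 1 -> p.[t] <= p.[0] + M * t ^+ 2.
Proof.
move=> e_gt0; elim/poly_ind: p => [|q a _].
  move=> _; exists 1 => // t _; rewrite !horner0 add0r mul1r.
  exact: sqr_ge0.
elim/poly_ind: q => [|q b _] pmin.
  exists 1 => // t _; rewrite mul0r add0r !hornerC mul1r lerDl.
  exact: sqr_ge0.
have pE t : ((q * 'X + b%:P) * 'X + a%:P).[t] = a + b * t + q.[t] * t ^+ 2.
  by rewrite !(hornerD, hornerM, hornerX, hornerC); ring.
have [N qN] := poly_itv_bound q (-1) 1.
pose M := `|N| + 1.
have M_gt0 : 0 < M by rewrite ltr_wpDl.
have qM t : `|t| <= 1 -> `|q.[t]| <= M.
  rewrite ler_norml => /qN /le_trans; apply.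
  by rewrite (le_trans (ler_norm N))// lerDl.
suff b0 : b = 0.
  exists M => // t /qM tM; rewrite !pE b0 expr0n /= !mul0r !mulr0 !addr0.
  rewrite lerD2l ler_wpM2r ?sqr_ge0//.
  exact: le_trans (ler_norm _) tM.
apply/eqP; apply: contraT => b_neq0.
have b_gt0 : 0 < `|b| by rewrite normr_gt0.
(* At |t| = d the linear term has size |b| d, while the bound d <= |b| / (2 M)
   keeps the remainder q(t) t^2 below half of it. *)
pose d := Num.min (Num.min e 1) (`|b| / (2 * M)).
have d_gt0 : 0 < d by rewrite !lt_min e_gt0 ltr01 divr_gt0// mulr_gt0.
have de : d <= e by rewrite !ge_min lexx.
have d1 : d <= 1 by rewrite !ge_min lexx orbT.
have dM : d * M <= `|b| / 2.
  have : d <= `|b| / (2 * M) by rewrite ge_min lexx orbT.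
  by rewrite invfM mulrA ler_pdivlMr.
pose t := - (Num.sg b * d).
have td : `|t| = d by rewrite normrN normrM normr_sg b_neq0 mul1r gtr0_norm.
have bt : b * t = - (`|b| * d).
  by rewrite /t mulrN mulrA [b * _]mulrC -normrEsg.
have t2 : t ^+ 2 = d ^+ 2 by rewrite -(real_normK (num_real t)) td.
have := pmin t; rewrite td => /(_ de).
rewrite !pE t2 bt !mulr0 expr0n /= !mulr0 !addr0 => lowt.
have qt : q.[t] * d ^+ 2 <= `|b| / 2 * d.
  rewrite expr2 mulrA ler_pM2r//.
  apply: le_trans dM; rewrite mulrC ler_pM2l//.
  by apply: le_trans (ler_norm _) (qM _ _); rewrite td.
have bd_gt0 := mulr_gt0 b_gt0 d_gt0.
lra.
Qed.

Lemma polyfun_line (R : realType) (n : nat) (f : {mpoly R[n]})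
    (x v : 'rV[R]_n) :
  exists p : {poly R}, forall t, polyfun f (x + t *: v) = p.[t].
Proof.
elim/mpolyind: f => [|c m g _ _ [p gp]].
  by exists 0 => t; rewrite /polyfun meval0 horner0.
exists (c *: \prod_i ((x ord0 i)%:P + v ord0 i *: 'X) ^+ m i + p) => t.
rewrite hornerD -gp /polyfun mevalD mevalZ mevalX hornerZ horner_prod.
congr (_ * _ + _); apply: eq_bigr => i _.
by rewrite !hornerE !mxE [t * _]mulrC.
Qed.

Lemma simplex_coord_le1 (R : realType) (n : nat) (x : 'rV[R]_n) (i : 'I_n) :
  simplex R n x -> x ord0 i <= 1.
Proof.
move=> [x0 x1]; rewrite -x1 (bigD1 i)//= lerDl.
by apply: sumr_ge0 => j _; exact: x0.
Qed.

(** The lower bound - x_i on t lets the line through x and the vertex i leave x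
    in both directions when x_i > 0: the other coordinates are scaled by
    1 - t >= 0, and the i-th one is x_i + t (1 - x_i) >= x_i + t when t <= 0. *)
Lemma simplex_shift (R : realType) (n : nat) (x : 'rV[R]_n) (i : 'I_n) (t : R) :
  simplex R n x -> - x ord0 i <= t <= 1 ->
  simplex R n (x + t *: (delta_mx ord0 i - x)).
Proof.
move=> xs /andP[xt t1]; have xi1 := simplex_coord_le1 R n x i xs.
have [x0 x1] := xs.
split=> [j|].
  rewrite !mxE eqxx /=; have [->|_] /= := eqVneq j i.
    have [t0|t0] := leP 0 t.
      by rewrite addr_ge0 ?x0// mulr_ge0// subr_ge0.
    have := x0 i; nra.
  have -> : x ord0 j + t * (0 - x ord0 j) = (1 - t) * x ord0 j by ring.
  by rewrite mulr_ge0 ?x0// subr_ge0.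
under eq_bigr do rewrite !mxE.
rewrite big_split /= -mulr_sumr sumrB x1 (bigD1 i)//= !eqxx big1 ?addr0.
  by rewrite subrr mulr0 addr0.
by move=> j /negbTE ->.
Qed.

(** The leftover mass r mod m goes to the vertex i: the r-th multiple of the
    shifted point is (r - r mod m) x + (r mod m) e_i. *)
Lemma mem_grid_shift (R : realType) (n m r : nat) (x : 'rV[R]_n) (i : 'I_n) :
  (0 < r)%N -> grid R n m x ->
  grid R n r (x + ((r %% m)%N%:R / r%:R) *: (delta_mx ord0 i - x)).
Proof.
move=> r_gt0 [xs xm]; have r0 : 0 < r%:R :> R by rewrite ltr0n.
split=> [|j].
  apply: simplex_shift => //; apply/andP; split.
    by rewrite (@le_trans _ _ 0)// ?oppr_le0 ?(proj1 xs)// divr_ge0.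
  by rewrite ler_pdivrMr// mul1r ler_nat leq_mod.
have rE : r%:R = (r %/ m)%N%:R * m%:R + (r %% m)%N%:R :> R.
  by rewrite -natrM -natrD -divn_eq.
rewrite !mxE eqxx /=.
set s := (r %% m)%N%:R in rE *; set k := (r %/ m)%N%:R in rE.
have -> : r%:R * (x ord0 j + s / r%:R * ((j == i)%:R - x ord0 j)) =
          k * (m%:R * x ord0 j) + s * (j == i)%:R.
  rewrite mulrDr [r%:R * (_ * _)]mulrA [r%:R * (s / _)]mulrC divfK ?(gt_eqF r0)//.
  by rewrite {1}rE; ring.
by rewrite rpredD// rpredM ?natr_nat.
Qed.

Lemma simplex_pos_coord (R : realType) (n : nat) (x : 'rV[R]_n) :
  simplex R n x -> exists i, 0 < x ord0 i.
Proof.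
move=> [x0 x1].
have : \sum_i x ord0 i != 0 by rewrite x1 oner_neq0.
by rewrite psumr_neq0// => /hasP[i _ xi]; exists i.
Qed.

Lemma rational_denom (R : realType) (x : R) :
  rational x -> 0 <= x -> exists2 d : nat, (0 < d)%N & d%:R * x \is a Num.nat.
Proof.
move=> [q _ <-] q_ge0; exists `|denq q|%N; first by rewrite absz_gt0 denq_neq0.
rewrite natrEint mulr_ge0// andbT.
have -> : `|denq q|%N%:R = (denq q)%:~R :> R.
  by rewrite -[in RHS](gtz0_abs (denq_gt0 q)).
by rewrite /ratr mulrC divfK ?intr_eq0 ?denq_neq0.
Qed.

Lemma rational_mem_grid (R : realType) (n : nat) (x : 'rV[R]_n) :
  simplex R n x -> (forall i, rational (x ord0 i)) ->
  exists2 m : nat, (0 < m)%N & grid R n m x.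
Proof.
move=> xs xq.
have /choice[d dP] i : exists d : nat,
    (0 < d)%N /\ d%:R * x ord0 i \is a Num.nat.
  by have [d d0 dx] := rational_denom R _ (xq i) (proj1 xs i); exists d.
exists (\prod_i d i)%N; first by apply: prodn_gt0 => i; case: (dP i).
split=> // i; rewrite (bigD1 i)//= mulnC natrM -mulrA rpredM ?natr_nat//.
by case: (dP i).
Qed.

Theorem corollary3p1 (R : realType) (n : nat) (n_gt0 : (1 <= n)%N)
    (f : {mpoly R[n]}) (f_cubic : f \is 3.-homog)
    (f_int : f \is a mpolyOver n Num.int)
    (f_gap : min_simplex f < max_simplex f)
    (f_ratmin : exists x : 'rV[R]_n,
      [/\ simplex R n x, forall i, rational (x ord0 i)
        & polyfun f x = min_simplex f]) :
  exists (C : R) (r0 : nat), forall r : nat,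
    (1 <= r)%N -> (r0 <= r)%N -> rho f r <= C / r%:R ^+ 2.
Proof.
have [x [xs xq fx]] := f_ratmin.
have [m m_gt0 xm] := rational_mem_grid _ _ _ xs xq.
have [i xi_gt0] := simplex_pos_coord _ _ _ xs.
have [p fp] := polyfun_line _ _ f x (delta_mx ord0 i - x).
have p0 : p.[0] = min_simplex f by rewrite -fp scale0r addr0.
have xi1 := simplex_coord_le1 _ _ _ i xs.
have pmin t : `|t| <= x ord0 i -> p.[0] <= p.[t].
  rewrite ler_norml => /andP[xt tx].
  have [c _ [fc cmin]] := min_simplexP n_gt0 f.
  rewrite p0 fc -fp; apply: cmin; apply: simplex_shift => //.
  by rewrite xt (le_trans tx).
have [M M_gt0 pM] := poly_local_min_quadratic _ _ _ xi_gt0 pmin.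
have gap_gt0 : 0 < max_simplex f - min_simplex f by rewrite subr_gt0.
exists (M * m%:R ^+ 2 / (max_simplex f - min_simplex f)), 0%N => r r_gt0 _.
have r0 : 0 < r%:R :> R by rewrite ltr0n.
pose t : R := (r %% m)%N%:R / r%:R.
have t_ge0 : 0 <= t by rewrite divr_ge0.
have t1 : `|t| <= 1.
  by rewrite ger0_norm// ler_pdivrMr// mul1r ler_nat leq_mod.
have tm : t <= m%:R / r%:R.
  by rewrite ler_pM2r ?invr_gt0// ler_nat ltnW// ltn_mod.
have grid_le : min_grid f r <= p.[t].
  have [c _ [-> cmin]] := min_gridP n_gt0 f r_gt0.
  by rewrite -fp; apply: cmin; exact: mem_grid_shift.
rewrite /rho mulrAC ler_pM2r ?invr_gt0// -p0 lerBlDl.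
apply: le_trans grid_le (le_trans (pM t t1) _).
rewrite lerD2l -mulrA ler_pM2l// -expr_div_n.
by rewrite lerXn2r// nnegrE divr_ge0.
Qed.
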